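(* Let $G$ be a $[3,3,3]$-partite graph. Then $O\chi(G)=3$.
   Context: A graph is $[n,k,r]$-partite if its vertex set can be partitioned into $n$ independent sets of size $k$ such that between every pair of these independent sets the edges form exactly $r$ pairwise disjoint edges, and there are no other edges. Two proper vertex colourings $c_1,c_2$ of a graph are orthogonal if whenever two distinct vertices receive the same colour in one colouring, they receive different colours in the other (equivalently, $v\mapsto (c_1(v),c_2(v))$ is injective). The orthogonal chromatic number $O\chi(G)$ is the minimum number $c$ such that $G$ has a pair of orthogonal proper vertex colourings each using at most $c$ colours. *)

(* Defs.v *)
From mathcomp Require Import all_boot.

Set Implicit Arguments.
Unset Strict Implicit.
Unset Printing Implicit Defensive.

Record sgraph := SGraph {
  vertex :> finType;
  adj : rel vertex;
  adj_sym : symmetric adj;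
  adj_irrefl : irreflexive adj
}.

Definition independent (G : sgraph) (A : {set G}) : Prop :=
  {in A &, forall x y, ~~ adj x y}.

Definition edges_between (G : sgraph) (A B : {set G}) : {set {set G}} :=
  [set [set x; y] | x in A, y in B & adj x y].

(* The parts are an indexed family rather than a [partition], because
   [partition] excludes empty blocks and so would mishandle k = 0. That G has
   no other edges follows from the parts being independent and covering G. *)
Definition nkr_partite (n k r : nat) (G : sgraph) : Prop :=
  exists V : 'I_n -> {set G},
    [/\ \bigcup_(i < n) V i = [set: G],
        forall i j, i != j -> [disjoint V i & V j],
        forall i, #|V i| = k,
        forall i, independent (V i)
      & forall i j, i != j ->
          #|edges_between (V i) (V j)| = r /\
          trivIset (edges_between (V i) (V j))].

Definition proper_colouring (G : sgraph) (C : eqType) (f : G -> C) : bool :=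
  [forall x, forall y, adj x y ==> (f x != f y)].

Definition orthogonal (G : sgraph) (C : eqType) (f g : G -> C) : bool :=
  [forall x, forall y, (x != y) ==>
     ((f x == f y) ==> (g x != g y)) && ((g x == g y) ==> (f x != f y))].

Definition orthogonally_colourable (G : sgraph) (c : nat) : bool :=
  [exists f : {ffun G -> 'I_c}, exists g : {ffun G -> 'I_c},
     [&& proper_colouring f, proper_colouring g & orthogonal f g]].

Lemma orthogonally_colourable_ex (G : sgraph) :
  exists c, orthogonally_colourable G c.
Proof.
exists #|G|; apply/existsP; exists [ffun x => enum_rank x].
apply/existsP; exists [ffun x => enum_rank x].
have inj x y : (enum_rank x == enum_rank y :> 'I_#|G|) = (x == y).
  exact: (inj_eq enum_rank_inj).
have proper : proper_colouring (G := G) [ffun x => enum_rank x].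
  apply/forallP => x; apply/forallP => y; rewrite !ffunE inj.
  by apply/implyP => xy; apply/eqP => exy; rewrite exy adj_irrefl in xy.
rewrite proper /=; apply/forallP => x; apply/forallP => y.
by rewrite !ffunE inj; case: (x == y).
Qed.

Definition orth_chromatic_number (G : sgraph) : nat :=
  ex_minn (orthogonally_colourable_ex G).

(* Main.v *)
Require Import Defs.
From mathcomp Require Import all_boot.

Set Implicit Arguments.
Unset Strict Implicit.
Unset Printing Implicit Defensive.

(** The three matchings are perfect, so following the matchings out of the first
part labels the vertices by cells (i, a), 0 <= i, a < 3, in such a way that the
first part is joined to the other two along equal labels a, while the last two
are joined along a permutation s of the labels. A pair of orthogonal proper
3-colourings is an injection into the 3 x 3 grid that never sends an edge into
a row or a column. If s is the identity or has no fixed point, the row can be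
taken to be i and the column a shift of a depending on i; if s is a
transposition, the graph is the disjoint union of a triangle and a hexagon,
which are sent to the diagonal of the grid and to its complement. *)

(** Since [k] disjoint edges cover [2k] vertices, they exhaust [A :|: B]; so each vertex of [A] has
    exactly one partner in [B], and [f] picks it. *)
Lemma perfect_matching (G : sgraph) (A B : {set G}) (k : nat) :
  [disjoint A & B] -> #|A| = k -> #|B| = k ->
  #|edges_between A B| = k -> trivIset (edges_between A B) ->
  exists f : G -> G,
    [/\ {in A, forall x, f x \in B}, {in A &, injective f}
      & {in A & B, forall x y, adj x y = (y == f x)}].
Proof.
move=> dAB cA cB cE tE.
have neqAB x y : x \in A -> y \in B -> x != y.
  by move=> xA yB; apply: contraTneq yB => <-; rewrite (disjointFr dAB xA).
have edge x y : x \in A -> y \in B -> adj x y -> [set x; y] \in edges_between A B.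
  by move=> xA yB xy; apply/imset2P; exists x y; rewrite ?inE ?yB.
have edgeP e : e \in edges_between A B ->
    exists x y, [/\ x \in A, y \in B, adj x y & e = [set x; y]].
  by case/imset2P=> x y xA; rewrite inE => /andP[yB xy] ->; exists x, y.
have edge_eq z e e' : e \in edges_between A B -> e' \in edges_between A B ->
    z \in e -> z \in e' -> e = e'.
  move=> eE e'E ze ze'; apply/eqP/contraT => /(trivIsetP tE _ _ eE e'E).
  by move/disjointFr=> /(_ z ze); rewrite ze'.
(* One inclusion is clear; disjoint edges of two vertices each give equal cardinalities. *)
have coverE : cover (edges_between A B) = A :|: B.
  apply/eqP; rewrite eqEcard; apply/andP; split.
    apply/bigcupsP=> e /edgeP[x [y [xA yB _ ->]]].
    by apply/subsetP=> z; rewrite !inE => /orP[]/eqP->; rewrite ?xA ?yB ?orbT.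
  rewrite cardsU disjoint_setI0 // cards0 subn0 cA cB.
  move: tE => /eqP <-; rewrite (eq_bigr (fun=> 2)).
    by rewrite sum_nat_const cE muln2 addnn.
  by move=> e /edgeP[x [y [xA yB _ ->]]]; rewrite cards2 neqAB.
have nbr x : x \in A -> exists2 y, y \in B & adj x y.
  move=> xA; have : x \in cover (edges_between A B) by rewrite coverE inE xA.
  case/bigcupP=> e /edgeP[x' [y [x'A yB xy ->]]]; rewrite !inE.
  by case/orP=> /eqP ex; [exists y; rewrite ?ex | case/eqP: (neqAB _ _ xA yB)].
(* The default [x] is never taken on [A], by [nbr]. *)
pose f x := odflt x [pick y in B | adj x y].
have fP x : x \in A -> f x \in B /\ adj x (f x).
  move=> /nbr[y yB xy]; rewrite /f; case: pickP => /= [z /andP[] // | /(_ y)].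
  by rewrite yB xy.
exists f; split=> [x /fP[] // | x x' xA x'A eqf | x y xA yB].
- have [fB xf] := fP _ xA; have [_ x'f] := fP _ x'A; rewrite -eqf in x'f.
  have ee := edge_eq (f x) _ _ (edge _ _ xA fB xf) (edge _ _ x'A fB x'f).
  have: x \in [set x'; f x] by rewrite -ee !inE ?eqxx ?orbT.
  by rewrite !inE (negbTE (neqAB _ _ xA fB)) orbF => /eqP.
- have [fB xf] := fP _ xA; apply/idP/eqP=> [xy | -> //].
  have ee := edge_eq x _ _ (edge _ _ xA yB xy) (edge _ _ xA fB xf).
  have: y \in [set x; f x] by rewrite -ee !inE ?eqxx ?orbT.
  by rewrite !inE eq_sym (negbTE (neqAB _ _ xA yB)) => /eqP.
Qed.

(* Adjacency of the cells [u] and [v] of the labelled graph, for [u] in an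
   earlier part than [v]. *)
Definition linked (s : nat -> nat) (u v : nat * nat) : bool :=
  (u.1 < v.1) && (v.2 == if u.1 == 0 then u.2 else s u.2).

Definition cells : seq (nat * nat) := [seq (i, a) | i <- iota 0 3, a <- iota 0 3].

(** A boolean over natural numbers, so that it is decided by computation once three values of [s]
    are known. *)
Definition orthogonal_cells (s : nat -> nat) (F G : nat * nat -> nat) : bool :=
  all (fun u => [&& F u < 3, G u < 3 & all (fun v =>
    (linked s u v ==> (F u != F v) && (G u != G v)) &&
    ((F u == F v) && (G u == G v) ==> (u == v))) cells]) cells.

Lemma orthogonal_cells_ex (s : 'I_3 -> 'I_3) : injective s ->
  exists F G, forall s' : nat -> nat, (forall a : 'I_3, s' a = s a) ->
    orthogonal_cells s' F G.
Proof.
move=> s_inj.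
pose o n (lt_n3 : n < 3) : 'I_3 := Ordinal lt_n3.
pose o0 := o 0 isT; pose o1 := o 1 isT; pose o2 := o 2 isT.
pose shift (d : nat -> nat) := fun u : nat * nat => (u.2 + d u.1) %% 3.
(* Colours for the transposition fixing [t]: the cells (i, t) form the triangle. *)
pose F t (u : nat * nat) :=
  nth 0 (nth [::] [:: [:: 0; 0; 0]; [:: 1; 1; 2]; [:: 2; 1; 2]] u.1)
    ((u.2 + 3 - t) %% 3).
pose G t (u : nat * nat) :=
  nth 0 (nth [::] [:: [:: 0; 1; 2]; [:: 1; 2; 1]; [:: 2; 0; 0]] u.1)
    ((u.2 + 3 - t) %% 3).
have n01 : s o0 != s o1 :> nat by apply/eqP=> /val_inj/s_inj.
have n02 : s o0 != s o2 :> nat by apply/eqP=> /val_inj/s_inj.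
have n12 : s o1 != s o2 :> nat by apply/eqP=> /val_inj/s_inj.
suff [F' [G' FG]] : exists F G, forall s' : nat -> nat,
    s' 0 = s o0 -> s' 1 = s o1 -> s' 2 = s o2 -> orthogonal_cells s' F G.
  exists F', G' => s' ss'.
  by apply: FG; [apply: (ss' o0) | apply: (ss' o1) | apply: (ss' o2)].
(* The six permutations come in lexicographic order: the identity, the transpositions fixing 0 and
   2, the two 3-cycles, the transposition fixing 1. *)
move: (s o0) (s o1) (s o2) n01 n02 n12 => [x ltx] [y lty] [z ltz] /=.
case: x ltx => [|[|[|//]]] _; case: y lty => [|[|[|//]]] _ //;
  case: z ltz => [|[|[|//]]] _ // _ _ _.
(* Cells with equal labels form triangles, so the three parts need distinct shifts. *)
- exists fst, (shift id) => s' e0 e1 e2.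
  by rewrite /orthogonal_cells /= /linked /= e0 e1 e2.
- exists (F 0), (G 0) => s' e0 e1 e2.
  by rewrite /orthogonal_cells /= /linked /= e0 e1 e2.
- exists (F 2), (G 2) => s' e0 e1 e2.
  by rewrite /orthogonal_cells /= /linked /= e0 e1 e2.
(* Edges from the first part keep the label and change the shift; the other edges keep the shift and
   change the label, as the 3-cycle has no fixed point. *)
- exists fst, (shift (fun i => 0 < i)) => s' e0 e1 e2.
  by rewrite /orthogonal_cells /= /linked /= e0 e1 e2.
- exists fst, (shift (fun i => 0 < i)) => s' e0 e1 e2.
  by rewrite /orthogonal_cells /= /linked /= e0 e1 e2.
- exists (F 1), (G 1) => s' e0 e1 e2.
  by rewrite /orthogonal_cells /= /linked /= e0 e1 e2.
Qed.

Definition cell (u : 'I_3 * 'I_3) : nat * nat := (val u.1, val u.2).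

Lemma cell_inj : injective cell.
Proof. by move=> [i a] [j b] [/val_inj -> /val_inj ->]. Qed.

Lemma cell_in (u : 'I_3 * 'I_3) : cell u \in cells.
Proof. by apply: allpairs_f; rewrite mem_iota /= ltn_ord. Qed.

(** An arbitrary numbering of the first part is carried along two of the matchings; the third, read
    in these labels, is [s]. *)
Lemma labelling (G : sgraph) : nkr_partite 3 3 3 G ->
  exists (phi : 'I_3 * 'I_3 -> G) (s : 'I_3 -> 'I_3),
    [/\ bijective phi, injective s
      & forall u v, adj (phi u) (phi v) ->
          linked (fun a => s (inord a)) (cell u) (cell v) ||
          linked (fun a => s (inord a)) (cell v) (cell u)].
Proof.
case=> V [covV disV cardV indV edgV].
pose o1 : 'I_3 := Ordinal (isT : 1 < 3); pose o2 : 'I_3 := Ordinal (isT : 2 < 3).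
have matching i j (nij : i != j) := perfect_matching
  (disV _ _ nij) (cardV i) (cardV j) (edgV _ _ nij).1 (edgV _ _ nij).2.
have [f1 [f1V f1_inj adj1]] := matching ord0 o1 isT.
have [f2 [f2V f2_inj adj2]] := matching ord0 o2 isT.
have [f [fV f_inj adjf]] := matching o1 o2 isT.
pose e (a : 'I_3) : G := enum_val (cast_ord (esym (cardV ord0)) a).
have eV a : e a \in V ord0 by apply: enum_valP.
have e_inj : injective e by move=> a b /enum_val_inj/cast_ord_inj.
pose phi (u : 'I_3 * 'I_3) :=
  if u.1 == 0 :> nat then e u.2
  else if u.1 == 1 :> nat then f1 (e u.2) else f2 (e u.2).
have ordE (i : 'I_3) : [\/ i = ord0, i = o1 | i = o2].
  by case: i => [[|[|[|//]]] lti]; [apply: Or31 | apply: Or32 | apply: Or33];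
    apply: val_inj.
have phiV u : phi u \in V u.1.
  by case: u => i a; case: (ordE i) => -> /=; [apply: eV | apply/f1V/eV | apply/f2V/eV].
have V_inj i j x : x \in V i -> x \in V j -> i = j.
  move=> xi xj; apply/eqP/contraT=> nij.
  by rewrite (disjointFr (disV _ _ nij) xi) in xj.
have phi_inj : injective phi.
  move=> u v euv; have e1 : u.1 = v.1.
    by apply: (V_inj _ _ (phi u)); rewrite // euv.
  case: u v e1 euv => i a [j b] /= <-.
  rewrite /phi; case: (ordE i) => -> /=.
  - by move/e_inj->.
  - by move/(f1_inj _ _ (eV a) (eV b))/e_inj->.
  - by move/(f2_inj _ _ (eV a) (eV b))/e_inj->.
(* The parts cover [G], so it has at most 9 vertices and the injection [phi] is onto. *)
have cardG : #|G| <= #|{: 'I_3 * 'I_3}|.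
  rewrite card_prod !card_ord -cardsT -covV.
  have -> : 3 * 3 = \sum_(i < 3) #|V i|.
    by rewrite (eq_bigr (fun=> 3)) ?sum_nat_const ?card_ord.
  apply: (big_ind2 (fun (A : {set G}) n => #|A| <= n)) => [|A m B n Am Bn|//].
    by rewrite cards0.
  by apply: leq_trans (leq_card_setU A B) (leq_add Am Bn).
have phi_bij : bijective phi by apply: inj_card_bij.
case: (phi_bij) => psi phiK psiK.
(* Only the label is kept: [f] lands in the last part, so the first coordinate is [o2]. *)
pose s a := (psi (f (phi (o1, a)))).2.
have sE a : f (phi (o1, a)) = phi (o2, s a).
  have -> : (o2, s a) = psi (f (phi (o1, a))); last by rewrite psiK.
  rewrite [RHS]surjective_pairing; congr pair.
  apply: (V_inj _ _ (f (phi (o1, a)))); first exact/fV/(phiV (o1, a)).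
  by rewrite -{1}[f _]psiK.
have s_inj : injective s.
  move=> a b eab; suff [] : (o1, a) = (o1, b) by [].
  by apply/phi_inj/f_inj; rewrite ?sE ?eab.
have linkP (u v : 'I_3 * 'I_3) : u.1 < v.1 -> adj (phi u) (phi v) ->
    linked (fun a => s (inord a)) (cell u) (cell v).
  case: u v => i a [j b]; case: (ordE i) => ->; case: (ordE j) => -> //= _.
  - by rewrite /phi /= adj1 ?eV ?f1V // => /eqP/(f1_inj _ _ (eV b) (eV a))/e_inj ->;
      rewrite /linked /=.
  - by rewrite /phi /= adj2 ?eV ?f2V // => /eqP/(f2_inj _ _ (eV b) (eV a))/e_inj ->;
      rewrite /linked /=.
  - rewrite adjf ?(phiV (o1, a)) ?(phiV (o2, b)) // sE => /eqP/phi_inj[->].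
    by rewrite /linked /= inord_val.
exists phi, s; split=> // u v uv.
case: (ltngtP u.1 v.1) => [lt_uv | lt_vu | /val_inj e1].
- by rewrite linkP.
- by rewrite orbC linkP // adj_sym.
- have vV : phi v \in V u.1 by rewrite e1.
  by case/negP: (indV u.1 _ _ (phiV u) vV).
Qed.

(** The pair of colours embeds the vertices in a [c] by [c] grid. *)
Lemma orthogonally_colourable_card (G : sgraph) (c : nat) :
  orthogonally_colourable G c -> #|G| <= c * c.
Proof.
case/existsP=> f /existsP[g /and3P[_ _ /forallP orth]].
rewrite -[c in c * _]card_ord -[c in _ * c]card_ord -card_prod.
apply: (leq_card (fun x => (f x, g x))) => x y [efx egx].
apply/eqP/contraT=> nxy; have /forallP/(_ y) := orth x.
by rewrite nxy efx egx !eqxx.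
Qed.

Theorem theorem2 (G : sgraph) (hG : nkr_partite 3 3 3 G) :
  orth_chromatic_number G = 3.
Proof.
have [phi [s [phi_bij s_inj phi_adj]]] := labelling hG.
have cardG : #|G| = 9 by rewrite -(bij_eq_card phi_bij) card_prod card_ord.
have [psi phiK psiK] := phi_bij.
have [F [H FH]] := orthogonal_cells_ex s_inj.
have {}FH : orthogonal_cells (fun a => s (inord a)) F H.
  by apply: FH => a; rewrite inord_val.
have ltFH x : F (cell (psi x)) < 3 /\ H (cell (psi x)) < 3.
  by have /allP/(_ _ (cell_in (psi x)))/and3P[] := FH.
have cellsP u v : (linked (fun a => s (inord a)) (cell u) (cell v) ->
      (F (cell u) != F (cell v)) && (H (cell u) != H (cell v))) /\
    (F (cell u) = F (cell v) -> H (cell u) = H (cell v) -> u = v).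
  have /allP/(_ _ (cell_in u))/and3P[_ _ /allP/(_ _ (cell_in v))] := FH.
  case/andP=> /implyP lnk /implyP inj; split=> // eF eH.
  by apply/cell_inj/eqP/inj; rewrite eF eH !eqxx.
pose f : {ffun G -> 'I_3} := [ffun x => Ordinal (ltFH x).1].
pose h : {ffun G -> 'I_3} := [ffun x => Ordinal (ltFH x).2].
have proper x y : adj x y -> (f x != f y) && (h x != h y).
  rewrite -{1}[x]psiK -{1}[y]psiK => /phi_adj.
  rewrite !ffunE -!val_eqE /=; case/orP=> /(cellsP _ _).1 //.
  by rewrite eq_sym [X in _ && ~~ X]eq_sym.
have fh_inj x y : f x = f y -> h x = h y -> x = y.
  rewrite !ffunE => -[eF] -[eH]; apply: (can_inj psiK).
  exact: (cellsP _ _).2.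
rewrite /orth_chromatic_number; case: ex_minnP => c cG min_c.
(* Lower bound: [9 <= c * c] excludes [c] equal to 0, 1 and 2. *)
apply/eqP; rewrite eqn_leq; apply/andP; split; last first.
  by move/orthogonally_colourable_card: cG; rewrite cardG; case: c {min_c} => [|[|[|]]].
apply: min_c; apply/existsP; exists f; apply/existsP; exists h.
apply/and3P; split; apply/forallP=> x; apply/forallP=> y; apply/implyP.
- by case/proper/andP.
- by case/proper/andP.
- move=> nxy; apply/andP; split; apply/implyP=> /eqP e1;
    by apply: contraNneq nxy => e2; apply/eqP/fh_inj.
Qed.
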